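(* Let $n,p\ge 1$, $X\in\mathbb{R}^{n\times p}$ with columns $X_1,\dots,X_p$, $\beta^*\in\mathbb{R}^p$, $\epsilon\in\mathbb{R}^n$, $Y=X\beta^*+\epsilon$, and $S=\mathrm{supp}(\beta^* )$. Let $\lambda>0$ and let $h_\lambda:\mathbb{R}\to\mathbb{R}$ be a convex differentiable function such that (i) $\sup_{t\in\mathbb{R}}|h_\lambda'(t)|\le\lambda$; (ii) $h_\lambda(-t)=h_\lambda(t)$ for all $t$; (iii) $h_\lambda(0)=h_\lambda'(0)=0$. Let $c\in(0,1)$ and let $$\mathcal{C}=\Big\{\nu\in\mathbb{R}^p:\ \|\nu_{S^c}\|_1\le \tfrac{5}{2c}\|\nu_S\|_1\Big\}.$$ Assume that there is $\gamma>0$ such that $\frac1n\nu^TX^TX\nu\ge\gamma\|\nu\|_2^2$ for all nonzero $\nu\in\mathcal{C}$, and that $\lambda\ge \frac{2\|X^T\epsilon\|_\infty}{n}$. Let $\hat\beta$ be a d-stationary point on $\mathbb{R}^p$ of $$F(\beta)=\frac1{2n}\|Y-X\beta\|_2^2+\lambda\|\beta\|_1-\sum_{i=1}^p h_\lambda(\beta_i),$$ and assume that $$\frac1n X_j^TX(\beta^*-\hat\beta)\,\mathrm{sign}(\hat\beta_j)\ \ge\ c\lambda\qquad\text{for all } j\in S^c \text{ with } \hat\beta_j\ne0 .$$ Then $$\|\hat\beta-\beta^*\|_2\le\frac{5}{2\gamma}\,\lambda\sqrt{\|\beta^*\|_0}.$$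
   Context: For $\beta\in\mathbb{R}^p$, $\mathrm{supp}(\beta)=\{i:\beta_i\ne0\}$ and $\|\beta\|_0=|\mathrm{supp}(\beta)|$; $S^c=\{1,\dots,p\}\setminus S$; $\nu_S$ is the subvector of $\nu$ indexed by $S$; $\|\cdot\|_1,\|\cdot\|_2,\|\cdot\|_\infty$ are the usual vector norms. The directional derivative of $F$ at $\beta_0$ in direction $\beta-\beta_0$ is $F'(\beta_0;\beta-\beta_0)=\lim_{\tau\to0+}\frac{F(\beta_0+\tau(\beta-\beta_0))-F(\beta_0)}{\tau}$. A point $\hat\beta\in\mathbb{R}^p$ is a d-stationary (directional-stationary) point of $F$ on $\mathbb{R}^p$ if $F'(\hat\beta;\beta-\hat\beta)\ge0$ for all $\beta\in\mathbb{R}^p$. *)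

(* Defs.v *)
From mathcomp Require Import all_boot all_order all_algebra.
From mathcomp Require Import all_classical all_reals all_analysis.

Set Implicit Arguments.
Unset Strict Implicit.
Unset Printing Implicit Defensive.

Import Order.TTheory GRing.Theory Num.Theory.
Import numFieldNormedType.Exports.

Local Open Scope classical_set_scope.
Local Open Scope ring_scope.

Definition supp (R : realType) (p : nat) (v : 'cV[R]_p) : {set 'I_p} :=
  [set i | v i ord0 != 0]%SET.

Definition l0norm (R : realType) (p : nat) (v : 'cV[R]_p) : nat := #|supp v|.

Definition l1norm (R : realType) (p : nat) (v : 'cV[R]_p) : R :=
  \sum_(i < p) `|v i ord0|.

Definition l2norm (R : realType) (p : nat) (v : 'cV[R]_p) : R :=
  Num.sqrt (\sum_(i < p) v i ord0 ^+ 2).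

Definition subvec (R : realType) (p : nat) (v : 'cV[R]_p) (S : {set 'I_p}) :
    'cV[R]_(#|S|) :=
  rowsub (fun k : 'I_(#|S|) => enum_val k) v.

(* Difference quotient at b0 in the direction v; the library's 'D_v f b0 is
   its two-sided limit, which need not exist for nonsmooth f. *)
Definition dir_quotient (R : realType) (p : nat) (F : 'cV[R]_p -> R)
    (b0 v : 'cV[R]_p) (tau : R) : R :=
  (F (b0 + tau *: v) - F b0) / tau.

Definition dir_deriv (R : realType) (p : nat) (F : 'cV[R]_p -> R)
    (b0 v : 'cV[R]_p) : R :=
  lim (dir_quotient F b0 v tau @[tau --> 0^'+]).

(* lim is total in the library, so existence of the one-sided limits is
   required explicitly. *)
Definition d_stationary (R : realType) (p : nat) (F : 'cV[R]_p -> R)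
    (b0 : 'cV[R]_p) : Prop :=
  forall b : 'cV[R]_p,
    cvg (dir_quotient F b0 (b - b0) tau @[tau --> 0^'+]) /\
    0 <= dir_deriv F b0 (b - b0).

Definition objective (R : realType) (n p : nat) (X : 'M[R]_(n, p))
    (Y : 'cV[R]_n) (lambda : R) (h : R -> R) (b : 'cV[R]_p) : R :=
  (2 * n%:R)^-1 * l2norm (Y - X *m b) ^+ 2 + lambda * l1norm b
  - \sum_(i < p) h (b i ord0).

Definition cone (R : realType) (p : nat) (S : {set 'I_p}) (c : R) :
    set 'cV[R]_p :=
  [set v | l1norm (subvec v (~: S)%SET) <= 5 / (2 * c) * l1norm (subvec v S)].

(* Main.v *)
(** Along a direction [v], the penalty [lambda |.|_1 - sum h] changes at most at
    rate [2 lambda |v|_1], because [h] is [lambda]-Lipschitz. With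
    [nu = bhat - bstar], stationarity in the direction [- nu_S] therefore gives
    [<X nu_S, X nu> / n <= (5/2) lambda |nu_S|_1], the extra [lambda / 2] coming
    from the noise, while the sign condition gives
    [<X nu_(S^c), X nu> / n <= - c lambda |nu_(S^c)|_1]. Adding the two,
    [0 <= |X nu|^2 / n <= (5/2) lambda |nu_S|_1 - c lambda |nu_(S^c)|_1], which
    puts [nu] in the cone, and the restricted eigenvalue condition with
    Cauchy-Schwarz on [S] concludes. *)
Require Import Defs.
From mathcomp Require Import all_boot all_order all_algebra.
From mathcomp Require Import all_classical all_reals all_analysis.
From mathcomp Require Import ring lra.

Set Implicit Arguments.
Unset Strict Implicit.
Unset Printing Implicit Defensive.

Import Order.TTheory GRing.Theory Num.Theory.
Import numFieldNormedType.Exports.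

Local Open Scope classical_set_scope.
Local Open Scope ring_scope.

Lemma lipschitz_derive1_bound (R : realType) (f : R -> R) (k a b : R) :
    (forall t, derivable f t 1) -> (forall t, `|derive1 f t| <= k) ->
  `|f b - f a| <= k * `|b - a|.
Proof.
move=> df dk; wlog ab : a b / a <= b => [wlogab|].
  have [|/ltW ba] := leP a b; first exact: wlogab.
  by rewrite distrC (distrC b); exact: wlogab.
have Df x : x \in `]a, b[ -> is_derive x 1 f (derive1 f x).
  by rewrite derive1E => _; exact/derivableP.
have cf : {within `[a, b], continuous f} by apply: derivable_within_continuous.
have [z _ ->] := MVT_segment ab Df cf.
by rewrite normrM ler_wpM2r.
Qed.

(** Cauchy-Schwarz against the constant vector: with [T] the sum and [Q] the sum of squares, the
    deviations [#|A| a i - T] have squares summing to [#|A| (#|A| Q - T ^+ 2)], which is therefore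
    nonnegative. *)
Lemma sqr_sumr_le (R : realFieldType) (I : finType) (A : {set I}) (a : I -> R) :
  (\sum_(i in A) a i) ^+ 2 <= #|A|%:R * \sum_(i in A) a i ^+ 2.
Proof.
set T := \sum_(i in A) a i; set Q := \sum_(i in A) a i ^+ 2.
have [A0|A_gt0] := posnP #|A|.
  by rewrite /T big1 ?expr0n ?A0 ?mul0r//= => i; rewrite (cards0_eq A0) inE.
have k_gt0 : 0 < #|A|%:R :> R by rewrite ltr0n.
have : 0 <= \sum_(i in A) (#|A|%:R * a i - T) ^+ 2.
  by apply: sumr_ge0 => i _; exact: sqr_ge0.
have -> : \sum_(i in A) (#|A|%:R * a i - T) ^+ 2 =
    #|A|%:R * (#|A|%:R * Q - T ^+ 2).
  under eq_bigr => i _ do rewrite sqrrB exprMn -mulrnAr.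
  rewrite big_split sumrB/= -mulr_sumr -mulr_suml -mulr_sumr.
  by rewrite sumr_const -/Q -/T -[_ *+ #|A|]mulr_natl; ring.
by rewrite pmulr_rge0// subr_ge0.
Qed.

Lemma l1norm_subvec (R : realType) (p : nat) (v : 'cV[R]_p) (A : {set 'I_p}) :
  l1norm (subvec v A) = \sum_(i in A) `|v i ord0|.
Proof.
rewrite /l1norm (big_enum_val (fun i => `|v i ord0|)).
by apply: eq_bigr => i _; rewrite mxE.
Qed.

Lemma sqr_l2norm (R : realType) (p : nat) (v : 'cV[R]_p) :
  l2norm v ^+ 2 = (v^T *m v) ord0 ord0.
Proof.
rewrite sqr_sqrtr; last by apply: sumr_ge0 => i _; exact: sqr_ge0.
by rewrite mxE; apply: eq_bigr => i _; rewrite mxE expr2.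
Qed.

Lemma dotC (R : realType) (p : nat) (u v : 'cV[R]_p) :
  (u^T *m v) ord0 ord0 = (v^T *m u) ord0 ord0.
Proof. by rewrite -[in RHS](trmxK u) -trmx_mul [RHS]mxE. Qed.

Lemma normr_dot_le (R : realType) (p : nat) (u v : 'cV[R]_p) :
  `|(u^T *m v) ord0 ord0| <= l1norm u * `|v|.
Proof.
rewrite mxE (le_trans (ler_norm_sum _ _ _))// /l1norm mulr_suml.
apply: ler_sum => i _; rewrite normrM mxE ler_wpM2l//.
rewrite [leRHS]/Num.Def.normr/= mx_normrE.
by apply/bigmax_geP; right; exists (i, ord0).
Qed.

Lemma sqr_l2normB (R : realType) (n : nat) (u w : 'cV[R]_n) (t : R) :
  l2norm (u - t *: w) ^+ 2 =
    l2norm u ^+ 2 - 2 * t * (w^T *m u) ord0 ord0 + t ^+ 2 * l2norm w ^+ 2.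
Proof.
rewrite !sqr_l2norm.
have -> : (u - t *: w)^T = u^T - t *: w^T by rewrite linearB/= linearZ.
rewrite mulmxBl !mulmxBr.
rewrite -!scalemxAl -!scalemxAr.
have := dotC u w.
move: (u^T *m u) (u^T *m w) (w^T *m u) (w^T *m w) => uu uw wu ww e.
by rewrite !mxE e; ring.
Qed.

(** The quadratic loss expands exactly into a term linear in [t] and a remainder in [t ^+ 2]. The l1
    norm and [h] each contribute at most [lambda * l1norm v] to the quotient, whence the factor
    2. *)
Lemma dir_quotient_objective_le (R : realType) (n p : nat) (X : 'M[R]_(n, p))
    (Y : 'cV[R]_n) (lambda : R) (h : R -> R) (b v : 'cV[R]_p) (t : R) :
    0 <= lambda -> (forall x y, `|h y - h x| <= lambda * `|y - x|) -> 0 < t ->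
  dir_quotient (objective X Y lambda h) b v t <=
    2 * lambda * l1norm v
    - n%:R^-1 * ((X *m v)^T *m (Y - X *m b)) ord0 ord0
    + (2 * n%:R)^-1 * l2norm (X *m v) ^+ 2 * t.
Proof.
move=> lambda_ge0 h_lip t_gt0; rewrite /dir_quotient ler_pdivrMr// /objective.
rewrite mulmxDr -scalemxAr opprD addrA sqr_l2normB.
have l1_le : l1norm (b + t *: v) - l1norm b <= t * l1norm v.
  rewrite /l1norm -sumrB mulr_sumr; apply: ler_sum => i _.
  rewrite !mxE lerBlDl (le_trans (ler_normD _ _))// normrM.
  by rewrite (ger0_norm (ltW t_gt0)).
have h_le : \sum_(i < p) h (b i ord0) - \sum_(i < p) h ((b + t *: v) i ord0)
    <= lambda * (t * l1norm v).
  rewrite /l1norm -sumrB !mulr_sumr; apply: ler_sum => i _.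
  rewrite (le_trans (ler_norm _))// (le_trans (h_lip _ _))//.
  rewrite !mxE opprD addNKr normrN normrM.
  by rewrite (ger0_norm (ltW t_gt0)).
have {}l1_le := ler_wpM2l lambda_ge0 l1_le.
rewrite invfM.
move: (n%:R^-1) => m.
by move: h_le l1_le; set q := l2norm _ ^+ 2; set r := _ ord0 ord0; nra.
Qed.

(** First-order condition, obtained by letting [t] tend to 0 from the right in the previous bound:
    the remainder vanishes and the limit of the quotient is nonnegative. *)
Lemma d_stationary_dot_le (R : realType) (n p : nat) (X : 'M[R]_(n, p))
    (Y : 'cV[R]_n) (lambda : R) (h : R -> R) (b v : 'cV[R]_p) :
    0 <= lambda -> (forall x y, `|h y - h x| <= lambda * `|y - x|) ->
    d_stationary (objective X Y lambda h) b ->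
  n%:R^-1 * ((X *m v)^T *m (Y - X *m b)) ord0 ord0 <= 2 * lambda * l1norm v.
Proof.
move=> lambda_ge0 h_lip /(_ (b + v)); rewrite addrAC subrr add0r => -[cvF F_ge0].
rewrite -subr_ge0 (le_trans F_ge0)//.
set A := _ - _; pose C := (2 * n%:R)^-1 * l2norm (X *m v) ^+ 2.
have cvg_affine : A + C * t @[t --> (0 : R)^'+] --> A.
  apply: cvg_at_right_filter; rewrite -[X in _ --> X]addr0 -[X in _ + X](mulr0 C).
  by apply: cvgD; [exact: cvg_cst|apply: cvgM; [exact: cvg_cst|exact: cvg_id]].
apply: (ler_cvg_to cvF cvg_affine); near=> t.
by apply: dir_quotient_objective_le => //; near: t; exact: nbhs_right_gt.
Unshelve. all: by end_near. Qed.

(* `|v| on a column vector is the library's sup norm of the entries. *)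
Theorem theorem4p1 (R : realType) (n p : nat) (n_gt0 : (0 < n)%N)
    (p_gt0 : (0 < p)%N) (X : 'M[R]_(n, p)) (bstar : 'cV[R]_p)
    (eps Y : 'cV[R]_n) (Y_def : Y = X *m bstar + eps)
    (lambda : R) (lambda_gt0 : 0 < lambda) (h : R -> R)
    (h_convex : convex_function [set: R^o] (h : R^o -> R^o))
    (h_derivable : forall t : R, derivable h t 1)
    (h_deriv_bound : (ereal_sup [set `|derive1 h t|%:E | t in [set: R]]
                      <= lambda%:E)%E)
    (h_even : forall t : R, h (- t) = h t)
    (h0 : h 0 = 0) (dh0 : derive1 h 0 = 0)
    (c : R) (c_gt0 : 0 < c) (c_lt1 : c < 1)
    (gamma : R) (gamma_gt0 : 0 < gamma)
    (restricted_eigenvalue : forall v : 'cV[R]_p,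
       cone (supp bstar) c v -> v != 0 ->
       gamma * l2norm v ^+ 2 <=
         n%:R^-1 * (v^T *m X^T *m X *m v) ord0 ord0)
    (lambda_ge : 2 * `|X^T *m eps| / n%:R <= lambda)
    (bhat : 'cV[R]_p)
    (bhat_dstat : d_stationary (objective X Y lambda h) bhat)
    (bhat_sign : forall j : 'I_p, j \notin supp bstar -> bhat j ord0 != 0 ->
       c * lambda <=
         n%:R^-1 * ((col j X)^T *m X *m (bstar - bhat)) ord0 ord0
           * Num.sg (bhat j ord0)) :
  l2norm (bhat - bstar) <=
    5 / (2 * gamma) * lambda * Num.sqrt (l0norm bstar)%:R.
Proof.
have h_lip a b : `|h b - h a| <= lambda * `|b - a|.
  apply: lipschitz_derive1_bound => // t; rewrite -lee_fin.
  by apply: le_trans h_deriv_bound; apply: ereal_sup_ubound; exists t.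
set S := supp bstar; set nu := bhat - bstar.
pose q := X^T *m (X *m nu); pose m : R := n%:R^-1.
have m_ge0 : 0 <= m by rewrite invr_ge0.
(* Extension of the restriction to [S] by zero, rather than [subvec], so that it can serve as a
   direction in the full space. *)
pose nuS : 'cV[R]_p := \col_i (if i \in S then nu i ord0 else 0).
pose T := \sum_(i in S) `|nu i ord0|.
have l1_nuS : l1norm nuS = T.
  rewrite /l1norm /T [RHS]big_mkcond; apply: eq_bigr => i _.
  by rewrite mxE; case: ifP => // _; rewrite normr0.
have on_S : m * \sum_(i in S) nu i ord0 * q i ord0 <= 5 / 2 * lambda * T.
  have dotE : \sum_(i in S) nu i ord0 * q i ord0 = (nuS^T *m q) ord0 ord0.
    rewrite big_mkcond mxE; apply: eq_bigr => i _; rewrite !mxE.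
    by case: ifP => // _; rewrite mul0r.
  have := d_stationary_dot_le (- nuS) (ltW lambda_gt0) h_lip bhat_dstat.
  have -> : Y - X *m bhat = eps - X *m nu.
    by rewrite Y_def mulmxBr opprB addrCA addrA.
  have -> : l1norm (- nuS) = T.
    by rewrite -l1_nuS /l1norm; apply: eq_bigr => i _; rewrite mxE normrN.
  rewrite trmx_mul -mulmxA mulmxBr mulmxBr.
  (* Hölder for the noise: [lambda_ge] makes this term at most [lambda / 2 * T] after scaling by
     [m], which raises the constant from 2 to 5/2. *)
  have := normr_dot_le nuS (X^T *m eps); rewrite l1_nuS.
  have T_ge0 : 0 <= T by apply: sumr_ge0.
  move: lambda_ge; rewrite dotE /q linearN/= !mulNmx.
  move: (nuS^T *m (X^T *m eps)) (nuS^T *m (X^T *m (X *m nu))) => e s.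
  rewrite -/m !mxE ler_norml => le_lambda /andP[_ e_le].
  have {}e_le := ler_wpM2l m_ge0 e_le.
  have {}le_lambda := ler_wpM2r T_ge0 le_lambda.
  by move: le_lambda e_le; rewrite -/m; nra.
have off_S i : i \notin S ->
    m * (nu i ord0 * q i ord0) <= - (c * lambda * `|nu i ord0|).
  move=> iS; have nuE : nu i ord0 = bhat i ord0.
    by move: iS; rewrite /S /supp inE negbK !mxE => /eqP->; rewrite subr0.
  rewrite nuE; have [->|b_neq0] := eqVneq (bhat i ord0) 0.
    by rewrite normr0 mul0r !mulr0 oppr0.
  have qE : ((col i X)^T *m X *m (bstar - bhat)) ord0 ord0 = - q i ord0.
    rewrite -opprB -/nu mulmxN mxE /q -mulmxA; congr (- _).
    by rewrite !mxE; apply: eq_bigr => k _; rewrite !mxE.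
  have := bhat_sign i iS b_neq0; rewrite qE -/m.
  (* Multiplying the sign condition by the modulus of [bhat i] replaces the sign by [bhat i] itself,
     which equals [nu i] off the support. *)
  move=> /(ler_wpM2l (normr_ge0 (bhat i ord0))).
  rewrite [in X in X -> _](mulrC `|_| (_ * Num.sg _)) -(mulrA _ (Num.sg _)) -numEsg.
  by nra.
pose U := \sum_(i in ~: S) `|nu i ord0|.
have quadE : (nu^T *m X^T *m X *m nu) ord0 ord0 = \sum_i nu i ord0 * q i ord0.
  by rewrite -!mulmxA mxE; apply: eq_bigr => i _; rewrite mxE.
have quad_le : m * (nu^T *m X^T *m X *m nu) ord0 ord0
    <= 5 / 2 * lambda * T - c * lambda * U.
  rewrite quadE (bigID (mem S))/= mulrDr lerD//.
  have -> : U = \sum_(i | i \notin S) `|nu i ord0|.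
    by apply: eq_bigl => i; rewrite inE.
  rewrite !mulr_sumr -sumrN.
  by apply: ler_sum => i /off_S.
have quad_ge0 : 0 <= m * (nu^T *m X^T *m X *m nu) ord0 ord0.
  by rewrite mulr_ge0// -mulmxA -trmx_mul -sqr_l2norm sqr_ge0.
(* Nonnegativity of the quadratic form gives [c * lambda * U <= 5 / 2 * lambda * T]; cancelling
   [lambda] and dividing by [c] yields the cone's constant. *)
have nu_cone : cone S c nu.
  rewrite /cone/= !l1norm_subvec -/T -/U invfM.
  have -> : 5 * (2^-1 / c) * T = (5 / 2 * T) / c by ring.
  rewrite ler_pdivlMr//.
  by have := le_trans quad_ge0 quad_le; nra.
have N_ge0 : 0 <= l2norm nu by exact: sqrtr_ge0.
(* The eigenvalue condition concerns nonzero vectors, and the last step cancels a factor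
   [l2norm nu]. *)
have [nu0|nu_neq0] := eqVneq nu 0.
  have -> : l2norm nu = 0.
    by rewrite /l2norm nu0 big1 ?sqrtr0// => i _; rewrite mxE expr0n.
  by rewrite !mulr_ge0 ?sqrtr_ge0 ?invr_ge0 ?mulr_ge0 ?(ltW lambda_gt0)
    ?(ltW gamma_gt0).
have T_ge0 : 0 <= T by exact: sumr_ge0.
have U_ge0 : 0 <= U by exact: sumr_ge0.
(* Cauchy-Schwarz on [S], whose cardinality is [l0norm bstar]; the sum of squares is then enlarged
   to all indices. *)
have T_le : T <= Num.sqrt (l0norm bstar)%:R * l2norm nu.
  rewrite -sqrtrM// -(ger0_norm T_ge0) -sqrtr_sqr ler_wsqrtr//.
  rewrite (le_trans (sqr_sumr_le _ _))// ler_wpM2l//.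
  rewrite big_mkcond/=; apply: ler_sum => i _.
  by case: ifP => _; rewrite ?sqr_ge0 ?real_normK ?num_real.
have nu_sqr_gt0 : 0 < l2norm nu.
  rewrite lt_neqAle N_ge0 andbT eq_sym; apply: contra nu_neq0.
  rewrite sqrtr_eq0 => nu_le0; apply/eqP/matrixP => i j; rewrite ord1 [RHS]mxE.
  have : \sum_(k < p) nu k ord0 ^+ 2 == 0
    by rewrite eq_le nu_le0 sumr_ge0// => k _; rewrite sqr_ge0.
  rewrite psumr_eq0 => [|k _]; last by rewrite sqr_ge0.
  by move=> /allP/(_ i (mem_index_enum i)); rewrite sqrf_eq0 => /eqP.
have := le_trans (restricted_eigenvalue nu nu_cone nu_neq0) quad_le.
have := mulr_ge0 (mulr_ge0 (ltW c_gt0) (ltW lambda_gt0)) U_ge0.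
move: T_le nu_sqr_gt0; set N := l2norm nu; set r := Num.sqrt _.
move=> T_le N_gt0 cU_ge0 N_le.
have {}T_le := ler_wpM2l (ltW lambda_gt0) T_le.
(* Scaled by [gamma * N], the goal bounds [gamma * N ^+ 2]. It follows from [N_le] by dropping the
   nonpositive term in [U] and applying [T_le]. *)
rewrite -(ler_pM2r N_gt0) -(ler_pM2l gamma_gt0).
have -> : gamma * (5 / (2 * gamma) * lambda * r * N) =
    5 / 2 * (lambda * (r * N)).
  by field; rewrite gt_eqF.
by nra.
Qed.
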